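(* Let $s\in\mathbb{C}$ with $\mathrm{Re}(s)>1$. For $k\in L$ let $q_k=\tilde p\big(H(k+\frac H2)+1\big)$ and $Z_s(a)=\prod_{k\in L}q_k^{-s\left(a(k)+\frac{H'}{2}\right)}$ for $a\in X$. Let $Y_{\mathbb Z}=\{a\in X:\ a(k)\in{}^{\star}({}^{*}\mathbb{Z})\text{ for all }k\in L\}$. Then $$\mathrm{st}\Big(\mathrm{st}\Big(\sum_{a\in Y_{\mathbb Z}}Z_s(a)\Big)\Big)=\zeta(s),$$ where $\zeta(s)=\prod_{l=1}^{\infty}\frac{1}{1-p(l)^{-s}}$ is the Riemann zeta function.
   Context: Double nonstandard framework: ${}^{*}S=S^{\Lambda_2}/F_2$ for a nonprincipal ultrafilter $F_2$ on an infinite set $\Lambda_2$; for a ${}^*$-internal set $S$, ${}^{\star}S$ is its ${}^*$-ultrapower with respect to ${}^*F_1$, $F_1$ a nonprincipal ultrafilter on an infinite set $\Lambda_1$; ''internal'' means internal with a double meaning. The inner $\mathrm{st}$ is the standard part map from ${}^{\star}({}^{*}\mathbb{C})$ (elements bounded by an element of ${}^*\mathbb{R}$) to ${}^{*}\mathbb{C}$, the outer one from finite elements of ${}^*\mathbb{C}$ to $\mathbb{C}$. Let $H\in{}^{*}\mathbb{Z}$ be a positive even infinite number and $H'\in{}^{\star}({}^{*}\mathbb{Z})$ a positive even number larger than every element of ${}^{*}\mathbb{Z}$; $\varepsilon=1/H$, $\varepsilon'=1/H'$. $L=\{\varepsilon z: z\in{}^*\mathbb{Z},\,-H/2\le\varepsilon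 z<H/2\}$ and $L'=\{\varepsilon' z': z'\in{}^{\star}({}^{*}\mathbb{Z}),\,-\frac{H'}{2}\le \varepsilon' z'<\frac{H'}{2}\}$. $X$ is the set of internal functions ${}^{\star}L\to L'$. Let $p:\mathbb{N}\to\{\text{primes}\}$ be the increasing enumeration $p(1)=2,p(2)=3,\dots$; ${}^*p([l_\mu])=[p(l_\mu)]$ and $\tilde p:{}^*\mathbb{N}\to{}^{\star}({}^*\{\text{primes}\})$, $\tilde p([l_\mu])={}^{\star}[p(l_\mu)]$. For $k\in L$, $H(k+\frac H2)+1\in{}^*\mathbb{N}$ ranges over $1,\dots,H^2$. Complex powers are $q^{z}=\exp(z\log q)$. $Y_{\mathbb Z}$ is the subgroup of $X$ whose coordinate projections are generated by $1$. (The paper writes $\mathbf{e}^\sharp(Z_s)$ for $Z_s$ regarded as a functional on $X$.) *)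

(* Defs.v *)
From HB Require Import structures.
From mathcomp Require Import all_boot all_order all_algebra.
From mathcomp Require Import archimedean complex.
From mathcomp Require Import all_classical all_reals all_analysis.

Set Implicit Arguments.
Unset Strict Implicit.
Unset Printing Implicit Defensive.

Import Order.TTheory GRing.Theory Num.Theory.
Import numFieldNormedType.Exports.

Local Open Scope classical_set_scope.
Local Open Scope ring_scope.
Local Open Scope complex_scope.

Definition ueq (I : Type) (F : set_system I) (T : Type) (f g : I -> T) : Prop :=
  F [set i | f i = g i].

Record star (I : Type) (F : set_system I) (T : Type) : Type := Star {
  ucar : set (I -> T);
  ucarP : exists f, ucar = ueq F f }.

HB.instance Definition _ (I : Type) (F : set_system I) (T : Type) :=
  gen_eqMixin (star F T).
HB.instance Definition _ (I : Type) (F : set_system I) (T : Type) :=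
  gen_choiceMixin (star F T).

Definition ucls (I : Type) (F : set_system I) (T : Type) (f : I -> T)
  : star F T := Star (ex_intro _ f erefl).

Definition urep (I : Type) (F : set_system I) (T : Type) (x : star F T)
  : I -> T := sval (cid (ucarP x)).

Definition ucst (I : Type) (F : set_system I) (T : Type) (t : T) : star F T :=
  ucls F (fun=> t).

(** Extensions of functions and relations to the ultrapower.  They are computed
    on chosen representatives; the result does not depend on the choice as soon
    as [F] is a filter. *)

Definition lift1 (I : Type) (F : set_system I) (A B : Type) (f : A -> B)
    (x : star F A) : star F B := ucls F (fun i => f (urep x i)).

Definition lift2 (I : Type) (F : set_system I) (A B C : Type) (f : A -> B -> C)
    (x : star F A) (y : star F B) : star F C :=
  ucls F (fun i => f (urep x i) (urep y i)).

Definition rel1 (I : Type) (F : set_system I) (A : Type) (P : A -> Prop)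
    (x : star F A) : Prop := F [set i | P (urep x i)].

Definition rel2 (I : Type) (F : set_system I) (A B : Type)
    (P : A -> B -> Prop) (x : star F A) (y : star F B) : Prop :=
  F [set i | P (urep x i) (urep y i)].

(** The *-ultrapower of *T with respect to *F1 is the extension to Λ2/F2 of the
    ultrapower construction T |-> T^Λ1/F1, that is (T^Λ1/F1)^Λ2/F2. *)

Section Double.
Context (I1 I2 : Type) (F1 : set_system I1) (F2 : set_system I2).

Definition dstar (T : Type) : Type := star F2 (star F1 T).

Definition emb (T : Type) (x : star F2 T) : dstar T := lift1 (@ucst _ F1 T) x.

Definition dcst (T : Type) (t : T) : dstar T := emb (ucst F2 t).

Definition dlift1 (A B : Type) (f : A -> B) : dstar A -> dstar B :=
  lift1 (lift1 f).

Definition dlift2 (A B C : Type) (f : A -> B -> C)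
  : dstar A -> dstar B -> dstar C := lift2 (lift2 f).

Definition drel1 (A : Type) (P : A -> Prop) : dstar A -> Prop :=
  rel1 (rel1 P).

Definition drel2 (A B : Type) (P : A -> B -> Prop)
  : dstar A -> dstar B -> Prop := rel2 (rel2 P).

(** The classes [[f_{μλ}]] of families of functions [A -> B] are the (doubly)
    internal functions, those of families of subsets of [A] the (doubly)
    internal sets. *)

Definition dapp (A B : Type) : dstar (A -> B) -> dstar A -> dstar B :=
  dlift2 (fun f x => f x).

Definition dset (A : Type) (S : dstar (set A)) : set (dstar A) :=
  [set x | drel2 (fun (B : set A) y => B y) S x].

(** For [S] an internal subset of *T, the subset of the double ultrapower formed
    by the classes modulo *F1 of the internal functions *Λ1 -> S. *)
Definition star_set (T : Type) (S : set (star F2 T)) : set (dstar T) :=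
  [set x | exists2 f : star F2 (I1 -> T),
     forall v : star F2 I1, S (lift2 (fun g j => g j) f v) &
     x = lift1 (@ucls _ F1 T) f].

(** Sums and products over internal hyperfinite sets: if [A] is
    [[A_{μλ}]] with A_{μλ} finite and [f] is [[f_{μλ}]] on [A], the value is
    [[ \big[op/idx]_(i \in A_{μλ}) f_{μλ} i ]].  The index set is allowed to be
    any set carried by an injection [e] onto an internal set, so that one can
    take products over L, which is identified with its *-ultrapower. *)
Definition is_hbig (K : Type) (op : K -> K -> K) (idx : K) (T : choiceType)
    (J : Type) (e : J -> dstar T) (A : set J) (f : J -> dstar K)
    (v : dstar K) : Prop :=
  exists (S : dstar (set T)) (g : dstar (T -> K)),
  [/\ drel1 (@finite_set T) S,
      set_inj A e,
      e @` A = dset S,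
      (forall j, A j -> f j = dapp g (e j)) &
      v = dlift2 (fun B h => \big[op/idx]_(i \in B) h i) S g].

Definition hbig (K : Type) (op : K -> K -> K) (idx : K) (T : choiceType)
    (J : Type) (e : J -> dstar T) (A : set J) (f : J -> dstar K) : dstar K :=
  xget (dcst idx) [set v | is_hbig op idx e A f v].

End Double.

Arguments star_set {I1 I2} F1 {F2 T} S _.

Definition cexp (R : realType) (z : R[i]) : R[i] :=
  (expR (complex.Re z))%:C *
  (cos (complex.Im z) +i* sin (complex.Im z)).

Definition cpow (R : realType) (q : nat) (z : R[i]) : R[i] :=
  cexp (z * (ln q%:R)%:C).

Lemma ex_prime_above (m : nat) : exists q : nat, (m < q)%N && prime q.
Proof. by have [q mq pq] := prime_above m; exists q; rewrite mq pq. Qed.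

(** [nth_prime 1 = 2], [nth_prime 2 = 3], ...; the value at 0 is irrelevant. *)
Fixpoint nth_prime (l : nat) : nat :=
  if l is l'.+1 then ex_minn (ex_prime_above (nth_prime l')) else 0.

Definition euler_prod (R : realType) (s : R[i]) (n : nat) : R[i] :=
  \prod_(1 <= l < n.+1) (1 - cpow (nth_prime l) (- s))^-1.

Definition zeta (R : realType) (s : R[i]) : R[i] :=
  lim ((euler_prod s : nat -> R[i]^o) @ \oo).

Section StandardPart.
Context (R : realType) (I1 I2 : Type) (F1 : set_system I1) (F2 : set_system I2).

Definition finite_elt (x : star F2 R[i]) : Prop :=
  exists r : R, rel1 (fun z => `|z| <= r%:C) x.

Definition st (x : star F2 R[i]) : R[i] :=
  xget 0 [set y | forall e : R, 0 < e -> rel1 (fun z => `|z - y| < e%:C) x].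

Definition star_bounded (x : dstar F1 F2 R[i]) : Prop :=
  exists r : star F2 R, drel2 (fun z (u : R) => `|z| <= u%:C) x (emb F1 r).

Definition star_st (x : dstar F1 F2 R[i]) : star F2 R[i] :=
  xget (ucst F2 0) [set y | forall e : star F2 R, rel1 (fun u => 0 < u) e ->
    drel2 (fun z (u : R) => `|z| < u%:C)
      (dlift2 (fun a b => a - b) x (emb F1 y)) (emb F1 e)].

End StandardPart.

Section Space.
Context (R : realType) (I1 I2 : Type) (F1 : set_system I1) (F2 : set_system I2).
Context (H : star F2 int) (H' : dstar F1 F2 int).

Definition lattice : set (star F2 R) :=
  [set x | (exists z : star F2 int,
              x = lift2 (fun (h w : int) => h%:~R^-1 * w%:~R) H z) /\
           rel2 (fun (h : int) (t : R) => - (h%:~R / 2) <= t < h%:~R / 2) H x].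

Definition lattice' : set (dstar F1 F2 R) :=
  [set x | (exists z : dstar F1 F2 int,
              x = dlift2 (fun (h w : int) => h%:~R^-1 * w%:~R) H' z) /\
           drel2 (fun (h : int) (t : R) => - (h%:~R / 2) <= t < h%:~R / 2) H' x].

(** An internal function on the *-ultrapower of L is represented by its unique
    internal extension that vanishes off this set. *)
Definition Xspace : set (dstar F1 F2 (R -> R)) :=
  [set a | (forall k, star_set F1 lattice k -> lattice' (dapp a k)) /\
           (forall k, ~ star_set F1 lattice k -> dapp a k = dcst F1 F2 0)].

Definition YZ : set (dstar F1 F2 (R -> R)) :=
  [set a | Xspace a /\ forall k, lattice k ->
     exists z : dstar F1 F2 int, dapp a (emb F1 k) = dlift1 intr z].

Definition ptilde (l : star F2 nat) : dstar F1 F2 nat :=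
  emb F1 (lift1 nth_prime l).

(** For k in L the real number H (k + H / 2) + 1 is a positive integer, so that
    [truncn] is a mere change of type. *)
Definition qprime (k : star F2 R) : dstar F1 F2 nat :=
  ptilde (lift2 (fun (h : int) (t : R) =>
    Num.truncn (h%:~R * (t + h%:~R / 2) + 1)) H k).

Definition Zfun (s : R[i]) (a : dstar F1 F2 (R -> R)) : dstar F1 F2 R[i] :=
  hbig *%R 1 (@emb I1 I2 F1 F2 R) lattice (fun k : star F2 R =>
    dlift2 (@cpow R) (qprime k)
      (dlift2 (fun (t : R) (h : int) => - s * (t + h%:~R / 2)%:C)
        (dapp a (emb F1 k)) H')).

End Space.

(* Main.v *)
Require Import Defs.
From HB Require Import structures.
From mathcomp Require Import all_boot all_order all_algebra.
From mathcomp Require Import archimedean complex.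
From mathcomp Require Import all_classical all_reals all_analysis.
From mathcomp Require Import ring lra zify.

Set Implicit Arguments.
Unset Strict Implicit.
Unset Printing Implicit Defensive.

Import Order.TTheory GRing.Theory Num.Theory.
Import numFieldNormedType.Exports.

Local Open Scope classical_set_scope.
Local Open Scope ring_scope.
Local Open Scope complex_scope.

(** The double ultrapower is the ultrapower over the Fubini product of the two
    ultrafilters, so that internal objects are classes of families indexed by
    pairs (μ, λ).  Since L_μ is finite, its F1-ultrapower adds no point; hence
    Y_Z is the internal set of all functions from L_μ to the h'_{μλ} integers of
    [-h'/2, h'/2), extended by 0.  Distributing the product over the sum gives
    sum Z_s = [ prod_(l <= h_μ^2) sum_(j < h'_{μλ}) p(l)^(-s j) ].
    As h' exceeds every element of *Z, the inner standard part replaces each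
    finite geometric sum by 1 / (1 - p(l)^(-s)), and as h is infinite the outer
    one is the limit of the Euler products.  These converge because
    sum_l p(l)^(-Re s) <= sum_n n^(-Re s) < oo. *)

(** * Ultrapowers *)

Section Ultrapower.
Context {I : Type} {F : set_system I} {F_ultra : UltraFilter F}.

Lemma ultraC (A : set I) : ~ F A -> F (~` A).
Proof. by have [|] := in_ultra_setVsetC A F_ultra. Qed.

Lemma ucls_eq (T : Type) (f g : I -> T) :
  ucls F f = ucls F g <-> F [set i | f i = g i].
Proof.
split=> [[fg]|fg].
  have : ueq F g g by apply: filterS filterT.
  by rewrite -fg.
have e : ueq F f = ueq F g.
  apply/funext => k; apply/propext; split; apply: filterS2 fg => i /= -> //.
rewrite /ucls; move: (ex_intro _ f _) (ex_intro _ g _).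
by rewrite e => p q; congr Star; exact: Prop_irrelevance.
Qed.

Lemma urepK (T : Type) (x : star F T) : ucls F (urep x) = x.
Proof.
case: x => X p; rewrite /urep /=; case: cid => f /= Xf.
rewrite /ucls; move: (ex_intro _ f _); rewrite -Xf => q.
by congr Star; exact: Prop_irrelevance.
Qed.

Lemma urep_ucls (T : Type) (f : I -> T) : F [set i | urep (ucls F f) i = f i].
Proof. by apply/ucls_eq; rewrite urepK. Qed.

Lemma rel1_ucls (T : Type) (P : T -> Prop) (x : I -> T) :
  rel1 P (ucls F x) <-> F [set i | P (x i)].
Proof. by split; apply: filterS2 (urep_ucls x) => i /= ->. Qed.

(** If every value [c k] were missed on a set of [F], finitely many such sets would meet in a set of
    [F], against the hypothesis. This is why a finite set gains no point in an ultrapower. *)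
Lemma ultra_finite_range (T : Type) (K : finType) (c : K -> T) (f : I -> T) :
  F [set i | exists k, f i = c k] -> exists k, F [set i | f i = c k].
Proof.
move=> Ff; apply: contrapT => /forallNP nf.
have {}nf k : F [set i | f i <> c k] by apply/ultraC/nf.
apply: (@filter_not_empty _ F _).
by apply: filterS2 Ff (filter_forall _ nf) => i [k fk] /(_ k).
Qed.

End Ultrapower.

(** * The double ultrapower as one ultrapower over pairs of indices *)

Section DoubleUltrapower.
Context {I1 I2 : Type} {F1 : set_system I1} {F2 : set_system I2}.
Context {F1_ultra : UltraFilter F1} {F2_ultra : UltraFilter F2}.

(** The quantifier of [F2] is the outer one, as in [dstar], where the [F1]-classes are formed inside
    the [F2]-ultrapower. *)
Definition fubini_filter : set_system (I2 * I1) :=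
  [set A | F2 [set m | F1 [set l | A (m, l)]]].
Local Notation D := fubini_filter.

#[global] Instance fubini_proper : ProperFilter D.
Proof.
split.
  move=> D0; apply: (@filter_not_empty _ F2 _); move: D0.
  by apply: (@filterS _ F2) => m; exact: (@filter_not_empty _ F1 _).
split.
- by apply: (@filterS _ F2) filterT => m _; apply: filterS filterT.
- by move=> A B; apply: (@filterS2 _ F2) => m; exact: filterI.
- by move=> A B AB; apply: (@filterS _ F2) => m; apply: filterS => l; exact: AB.
Qed.

#[global] Instance fubini_ultra : UltraFilter D.
Proof.
split=> [|G PG DG]; first exact: fubini_proper.
rewrite eqEsubset; split=> // A GA; apply: contrapT => nDA.
have /DG GnA : D (~` A).
  by move: nDA => /(@ultraC _ F2); apply: (@filterS _ F2) => m /ultraC.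
by apply: (@filter_not_empty _ G _); rewrite -(setICl A); exact: filterI.
Qed.

Lemma fubini_fst (A : set I2) : D [set p | A p.1] <-> F2 A.
Proof.
split; apply: (@filterS _ F2) => m; last by move=> Am; apply: filterS filterT.
by move=> F1A; apply: contrapT => nAm; apply: (@filter_not_empty _ F1 _);
  apply: filterS F1A.
Qed.

Definition dcls (T : Type) (f : I2 * I1 -> T) : dstar F1 F2 T :=
  ucls F2 (fun m => ucls F1 (fun l => f (m, l))).

Definition drep (T : Type) (x : dstar F1 F2 T) (p : I2 * I1) : T :=
  urep (urep x p.1) p.2.

Lemma drepK (T : Type) (x : dstar F1 F2 T) : dcls (drep x) = x.
Proof.
rewrite -[RHS]urepK /dcls; congr ucls; apply/funext => m.
exact: (urepK (urep x m)).
Qed.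

Lemma dcls_eq (T : Type) (f g : I2 * I1 -> T) :
  dcls f = dcls g <-> D [set p | f p = g p].
Proof.
rewrite ucls_eq; split; apply: (@filterS _ F2) => m /=; first by move/ucls_eq.
by move=> h; exact/ucls_eq.
Qed.

Lemma drep_dcls (T : Type) (f : I2 * I1 -> T) :
  D [set p | drep (dcls f) p = f p].
Proof. by apply/dcls_eq; rewrite drepK. Qed.

Lemma dlift1_dcls (A B : Type) (f : A -> B) (x : I2 * I1 -> A) :
  dlift1 f (dcls x) = dcls (fun p => f (x p)).
Proof.
apply/(@dcls_eq _ (fun p => f (drep (dcls x) p))).
by apply: filterS (drep_dcls x) => p /= ->.
Qed.

Lemma dlift2_dcls (A B C : Type) (f : A -> B -> C) (x : I2 * I1 -> A)
    (y : I2 * I1 -> B) :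
  dlift2 f (dcls x) (dcls y) = dcls (fun p => f (x p) (y p)).
Proof.
apply/(@dcls_eq _ (fun p => f (drep (dcls x) p) (drep (dcls y) p))).
by apply: filterS2 (drep_dcls x) (drep_dcls y) => p /= -> ->.
Qed.

Lemma dapp_dcls (A B : Type) (f : I2 * I1 -> A -> B) (x : I2 * I1 -> A) :
  dapp (dcls f) (dcls x) = dcls (fun p => f p (x p)).
Proof. exact: dlift2_dcls. Qed.

Lemma dapp_drep (A B : Type) (f : dstar F1 F2 (A -> B)) (x : dstar F1 F2 A) :
  D [set p | drep (dapp f x) p = drep f p (drep x p)].
Proof.
by apply/dcls_eq; rewrite drepK -[in LHS](drepK f) -[in LHS](drepK x) dapp_dcls.
Qed.

Lemma drel1_dcls (A : Type) (P : A -> Prop) (x : I2 * I1 -> A) :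
  drel1 P (dcls x) <-> D [set p | P (x p)].
Proof.
change (D [set p | P (drep (dcls x) p)] <-> D [set p | P (x p)]).
by split; apply: filterS2 (drep_dcls x) => p /= ->.
Qed.

Lemma drel2_dcls (A B : Type) (P : A -> B -> Prop) (x : I2 * I1 -> A)
    (y : I2 * I1 -> B) :
  drel2 P (dcls x) (dcls y) <-> D [set p | P (x p) (y p)].
Proof.
change (D [set p | P (drep (dcls x) p) (drep (dcls y) p)] <->
  D [set p | P (x p) (y p)]).
by split; apply: filterS3 (drep_dcls x) (drep_dcls y) => p /= -> ->.
Qed.

Lemma dset_dcls (T : Type) (S : I2 * I1 -> set T) (x : I2 * I1 -> T) :
  dset (dcls S) (dcls x) <-> D [set p | S p (x p)].
Proof. exact: (drel2_dcls (fun B y => B y)). Qed.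

Lemma emb_ucls (T : Type) (f : I2 -> T) :
  emb F1 (ucls F2 f) = dcls (fun p => f p.1).
Proof. by apply/ucls_eq; apply: filterS (urep_ucls f) => m /= ->. Qed.

Lemma dcstE (T : Type) (t : T) : Defs.dcst F1 F2 t = dcls (fun=> t).
Proof. exact: (emb_ucls (fun=> t)). Qed.

Lemma embE (T : Type) (x : star F2 T) : emb F1 x = dcls (fun p => urep x p.1).
Proof. by []. Qed.

Lemma emb_inj (T : Type) : injective (@emb I1 I2 F1 F2 T).
Proof.
move=> x y; rewrite !embE => /dcls_eq xy.
rewrite -[x]urepK -[y]urepK; apply/ucls_eq.
exact/(fubini_fst [set m | urep x m = urep y m]).
Qed.

(** Inclusion passes to almost all coordinates: otherwise a point of [A p] outside [B p] can be
    chosen for almost every [p], and its class lies in the first internal set but not in the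
    second. *)
Lemma dset_inj (T : choiceType) (t0 : T) (S S' : I2 * I1 -> set T) :
  dset (dcls S) = dset (dcls S') -> D [set p | S p = S' p].
Proof.
have sub (A B : I2 * I1 -> set T) : dset (dcls A) `<=` dset (dcls B) ->
    D [set p | A p `<=` B p].
  move=> AB; apply: contrapT => /ultraC nAB.
  pose x p := xget t0 (A p `\` B p).
  have {}nAB : D [set p | (A p `\` B p) (x p)].
    apply: filterS nAB => p /existsNP[t /not_implyP nt].
    by apply: xgetPex; exists t.
  have /AB /dset_dcls xB : dset (dcls A) (dcls x).
    by apply/dset_dcls; apply: filterS nAB => p [].
  apply: (@filter_not_empty _ D _).
  by apply: filterS2 nAB xB => p [].
move=> SS'; have h1 : D [set p | S p `<=` S' p] by apply: sub; rewrite SS'.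
have h2 : D [set p | S' p `<=` S p] by apply: sub; rewrite SS'.
by apply: filterS2 h1 h2 => p; rewrite /= eqEsubset.
Qed.

Lemma eq_on_dset (T : choiceType) (t0 : T) (K : Type) (S : I2 * I1 -> set T)
    (g g' : I2 * I1 -> T -> K) :
  (forall x, dset (dcls S) x -> dapp (dcls g) x = dapp (dcls g') x) ->
  D [set p | {in S p, g p =1 g' p}].
Proof.
move=> gg'; apply: contrapT => /ultraC ngg'.
pose N p := [set t | S p t /\ g p t <> g' p t].
pose x p := xget t0 (N p).
have {ngg'}Nx : D [set p | N p (x p)].
  apply: filterS ngg' => p /existsNP[t /not_implyP[/set_mem St nt]].
  by apply: xgetPex; exists t.
have /gg' : dset (dcls S) (dcls x).
  by apply/dset_dcls; apply: filterS Nx => p [].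
rewrite !dapp_dcls => /dcls_eq xx.
apply: (@filter_not_empty _ D _).
by apply: filterS2 Nx xx => p [].
Qed.

(** [hbig] selects a value through an unspecified representation of index set and family. By
    [dset_inj] and [eq_on_dset], two representations agree in almost every coordinate, so any one of
    them computes the value. *)
Lemma hbig_dcls (K : Type) (idx : K) (op : Monoid.com_law idx) (T : choiceType)
    (t0 : T) (J : Type) (e : J -> dstar F1 F2 T) (A : set J)
    (f : J -> dstar F1 F2 K) (S : I2 * I1 -> set T) (g : I2 * I1 -> T -> K) :
  D [set p | finite_set (S p)] -> set_inj A e -> e @` A = dset (dcls S) ->
  (forall j, A j -> f j = dapp (dcls g) (e j)) ->
  hbig op idx e A f = dcls (fun p => \big[op/idx]_(i \in S p) g p i).
Proof.
move=> finS injA eA fg; rewrite /hbig.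
set w := dcls _; case: xgetP => [v _|/(_ w)]; last first.
  case; exists (dcls S), (dcls g); split => //; first exact/drel1_dcls.
  by rewrite dlift2_dcls.
move=> [S' [g' [_ _ eA' fg' ->]]].
rewrite -(drepK S') -(drepK g') in eA' fg' *.
rewrite dlift2_dcls; apply/dcls_eq.
have SS' : D [set p | S p = drep S' p] by apply: (dset_inj t0); rewrite -eA -eA'.
have gg' : D [set p | {in S p, g p =1 drep g' p}].
  apply: (eq_on_dset t0) => x; rewrite -eA => -[j Aj <-].
  by rewrite -fg// fg'.
by apply: filterS2 SS' gg' => p /= -> h; apply/esym/eq_fsbigr.
Qed.

End DoubleUltrapower.

Arguments fubini_filter {I1 I2} F1 F2 _.

(** * The Euler product *)

Section RealSeries.
Context {R : realType}.

(* Cauchy condensation: the terms of index in [2^k - 1, 2^(k+1) - 1) add up to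
   at most (2^(1-a))^k. *)
Lemma cvg_riemannR (a : R) : 1 < a -> cvgn (series (riemannR a)).
Proof.
move=> a1; have a0 : 0 <= a by lra.
pose q : R := 2 `^ (1 - a).
have q0 : 0 < q by rewrite powR_gt0.
have q1 : q < 1.
  rewrite -(@powRr0 _ 2) /q /powR pnatr_eq0 /= ltr_expR mul0r.
  by rewrite pmulr_llt0 ?ln_gt0 ?ltr1n// subr_lt0.
have block k : \sum_((2 ^ k).-1 <= n < (2 ^ k.+1).-1) riemannR a n <= q ^+ k.
  have k0 : (0 < 2 ^ k)%N by rewrite expn_gt0.
  (* [riemannR a n] is (n+1)^(-a), so the block has 2^k terms, each at most (2^k)^(-a), and [q ^+ k]
     is 2^k copies of this bound. *)
  have -> : q ^+ k = \sum_((2 ^ k).-1 <= n < (2 ^ k.+1).-1) ((2 ^ k)%:R `^ a)^-1.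
    rewrite sumr_const_nat expnS (_ : (_ - _)%N = (2 ^ k)%N); last by lia.
    rewrite -[RHS]mulr_natr [RHS]mulrC -[X in _ = X / _]powRr1// -powRB; last first.
      by rewrite pnatr_eq0 expn_eq0 implybT.
    rewrite natrX -[X in _ = X `^ _]powR_mulrn// -powRrM mulrC powRrM.
    by rewrite powR_mulrn// ltW.
  apply: ler_sum_nat => n /andP[kn _].
  rewrite /riemannR lef_pV2 ?posrE ?powR_gt0 ?ltr0n//.
  rewrite ge0_ler_powR// ?nnegrE// ler_nat; lia.
have dyadic k : series (riemannR a) (2 ^ k).-1 <= series (geometric 1 q) k.
  elim: k => [|k IH]; first by rewrite expn0 /series /= !big_geq.
  rewrite /series /= (big_cat_nat (n := (2 ^ k).-1))//=; last by rewrite expnS; lia.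
  by rewrite big_nat_recr//= lerD// mul1r.
apply: nondecreasing_is_cvgn.
  apply/nondecreasing_seqP => n.
  by rewrite /series /= big_nat_recr//= lerDl ltW// riemannR_gt0.
exists (1 * (1 - q)^-1) => _ [n _ <-].
apply: (@le_trans _ _ (series (geometric 1 q) n)); last first.
  by apply: geometric_le_lim; rewrite // gtr0_norm.
apply: le_trans (dyadic n).
rewrite /series /= (big_cat_nat (n := n) (p := (2 ^ n).-1))//=; last first.
  by have := ltn_expl n (isT : 1 < 2)%N; lia.
by rewrite lerDl sumr_ge0// => i _; rewrite ltW// riemannR_gt0.
Qed.

End RealSeries.

(** * Convergence of complex sequences *)

Section ComplexSequences.
Context {R : realType}.
Implicit Types (z : R[i]) (u : nat -> R[i]).

Lemma gt0c z : 0 < z -> z = (complex.Re z)%:C /\ 0 < complex.Re z.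
Proof. by case: z => x y; rewrite ltcE /= => /andP[/eqP -> ->]. Qed.

(** The norm on [R[i]] has values in [R[i]], but positive elements there are real, so real
    tolerances suffice. *)
Lemma cvgcP u z : (u : nat -> R[i]^o) @ \oo --> (z : R[i]^o) <->
  forall e : R, 0 < e -> \forall n \near \oo, `|u n - z| < e%:C.
Proof.
split=> [/cvgrPdist_lt uz e e0|uz].
  have e0' : 0 < e%:C by rewrite ltcR.
  by apply: filterS (uz _ e0') => n; rewrite distrC.
apply/cvgrPdist_lt => eps /gt0c[-> e0].
by apply: filterS (uz _ e0) => n; rewrite distrC.
Qed.

Lemma norm_complex_le z : `|z| <= (`|complex.Re z| + `|complex.Im z|)%:C.
Proof.
rewrite {1}[z]complexE (le_trans (ler_normD _ _))// normrM rmorphD /=.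
rewrite lerD//; first by rewrite normc_def/= expr0n addr0 sqrtr_sqr.
by rewrite !normc_def/= expr0n/= expr1n add0r addr0 sqrtr1 mul1r sqrtr_sqr.
Qed.

Lemma Re_norm_le z (r : R) : `|z| <= r%:C -> `|complex.Re z| <= r.
Proof. by move=> zr; rewrite -lecR (le_trans (normc_ge_Re z)). Qed.

Lemma Im_norm_le z (r : R) : `|z| <= r%:C -> `|complex.Im z| <= r.
Proof.
move=> zr; rewrite -normrN -ReiNIm; apply: Re_norm_le.
by rewrite normrM [X in _ * X]normc_def/= expr0n/= expr1n add0r sqrtr1 mulr1.
Qed.

Lemma cvg_real_increments (f a : nat -> R) :
  (forall n, `|f n.+1 - f n| <= a n) -> cvgn (series a) -> cvgn f.
Proof.
move=> fa ca.
have -> : f = (fun n => f 0%N + series (telescope f) n).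
  by apply/funext => n; exact: eq_sum_telescope.
apply: is_cvgD; first exact: is_cvg_cst.
apply: normed_cvg; apply: series_le_cvg ca => n //=; last exact: fa.
by rewrite (le_trans _ (fa n)).
Qed.

(** Real and imaginary parts have increments dominated by the same summable sequence, so both
    converge by telescoping. *)
Lemma cvg_complex_increments u (a : nat -> R) :
  (forall n, `|u n.+1 - u n| <= (a n)%:C) -> cvgn (series a) ->
  cvg ((u : nat -> R[i]^o) @ \oo).
Proof.
move=> ua ca.
have cx : cvgn (fun n => complex.Re (u n)).
  apply: cvg_real_increments ca => n.
  by have := Re_norm_le (ua n); rewrite -(raddfB (@complex.Re R : Rcomplex R -> R)).
have cy : cvgn (fun n => complex.Im (u n)).
  apply: cvg_real_increments ca => n.
  by have := Im_norm_le (ua n); rewrite -(raddfB (@complex.Im R : Rcomplex R -> R)).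
apply/cvg_ex; exists (limn (fun n => complex.Re (u n)) +i*
                      limn (fun n => complex.Im (u n))).
apply/cvgcP => e e0; have e20 : 0 < e / 2 by lra.
have /cvgrPdist_lt /(_ _ e20) hx := cx; have /cvgrPdist_lt /(_ _ e20) hy := cy.
apply: filterS2 hx hy => n hx hy.
apply: (le_lt_trans (norm_complex_le _)); rewrite ltcR.
rewrite [ltRHS](splitr e) ltrD//.
  by move: hx; rewrite distrC; case: (u n).
by move: hy; rewrite distrC; case: (u n).
Qed.

End ComplexSequences.

(** * Multiplicativity and modulus of complex powers *)

Section ComplexPowers.
Context {R : realType}.
Implicit Types (z w : R[i]) (q : nat).

Lemma cexpD z w : cexp (z + w) = cexp z * cexp w.
Proof.
case: z => a b; case: w => c d; rewrite /cexp /= expRD cosD sinD.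
by apply/eqP; rewrite eq_complex /=; apply/andP; split; apply/eqP; ring.
Qed.

Lemma cexp0 : cexp (0 : R[i]) = 1.
Proof. by rewrite /cexp /= expR0 cos0 sin0 mul1r. Qed.

Lemma norm_cexp z : `|cexp z| = (expR (complex.Re z))%:C.
Proof.
rewrite /cexp normrM [X in _ * X]normc_def /= cos2Dsin2 sqrtr1 mulr1.
by rewrite normc_def /= expr0n addr0 sqrtr_sqr gtr0_norm// expR_gt0.
Qed.

(** Turns q^(-s j) into the j-th term of a geometric progression. *)
Lemma cpowMn q z (n : nat) : cpow q (z * n%:R) = cpow q z ^+ n.
Proof.
rewrite /cpow; elim: n => [|n IH]; first by rewrite mulr0 mul0r cexp0.
by rewrite -natr1 mulrDr mulr1 mulrDl cexpD IH exprSr.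
Qed.

Lemma norm_cpowN q z : (0 < q)%N -> `|cpow q (- z)| = (q%:R `^ (- complex.Re z))%:C.
Proof.
move=> q0; rewrite norm_cexp /powR pnatr_eq0 (gtn_eqF q0).
by case: z => a b /=; rewrite mulr0 subr0.
Qed.

End ComplexPowers.

(** Each prime exceeds the previous one, so p(l+1) is at least l+1; this bound compares the sum over
    primes with the sum over all positive integers. *)
Lemma nth_primeP (l : nat) : prime (nth_prime l.+1) /\ (l < nth_prime l.+1)%N.
Proof.
elim: l => [|l [_ IH]] /=; case: ex_minnP => q /andP[lq pq] _; split=> //.
exact: leq_ltn_trans IH lq.
Qed.

#[local] Arguments nth_prime : simpl never.

(** * Convergence of the Euler product for Re s > 1 *)

Section EulerProduct.
Context {R : realType} (s : R[i]) (s_gt1 : 1 < complex.Re s).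
Local Notation w l := (cpow (nth_prime l) (- s)).
Local Notation sigma := (complex.Re s).

Let s_ge0 : 0 <= sigma.
Proof. exact: le_trans ler01 (ltW s_gt1). Qed.

Lemma norm_prime_cpow (l : nat) : (0 < l)%N ->
  `|w l| = ((nth_prime l)%:R `^ (- sigma))%:C.
Proof.
by case: l => // l _; rewrite norm_cpowN// prime_gt0//; have [] := nth_primeP l.
Qed.

Lemma prime_powR_le_half (l : nat) : (0 < l)%N ->
  (nth_prime l)%:R `^ (- sigma) <= 2^-1 :> R.
Proof.
case: l => // l _; have [/prime_gt1 p1 _] := nth_primeP l.
rewrite powRN lef_pV2 ?posrE ?powR_gt0 ?ltr0n// 1?ltnW//.
apply: (@le_trans _ _ (2 `^ sigma)); last first.
  by rewrite ge0_ler_powR// ?nnegrE// ler_nat.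
rewrite -[leLHS]powRr1//; apply: ler_powR; first by rewrite ler1n.
exact: ltW.
Qed.

Lemma one_sub_prime_cpow_neq0 (l : nat) : (0 < l)%N -> 1 - w l != 0.
Proof.
move=> l0; rewrite subr_eq0; apply/eqP => /(congr1 Num.norm).
rewrite norm_prime_cpow// normr1 => -[] h.
by have := prime_powR_le_half l0; rewrite -h; lra.
Qed.

(** With w = p(l)^(-s), the difference is w / (1 - w), and |1 - w| >= 1 - |w| >= 1/2. *)
Lemma norm_euler_factor_sub1 (l : nat) : (0 < l)%N ->
  `|(1 - w l)^-1 - 1| <= (2 * (nth_prime l)%:R `^ (- sigma))%:C.
Proof.
move=> l0; have n0 := one_sub_prime_cpow_neq0 l0.
have -> : (1 - w l)^-1 - 1 = w l / (1 - w l) by field.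
have half := prime_powR_le_half l0.
set r := _ `^ _ in half *.
rewrite normrM norm_prime_cpow// -/r rmorphM /= mulrC ler_pM// ?ler0c ?powR_ge0//.
rewrite normfV -[leRHS]invrK lef_pV2 ?posrE ?normr_gt0 ?invr_gt0 ?ltcR//.
apply: (@le_trans _ _ (1 - `|w l|)); last by rewrite -[X in X - _]normr1 lerB_dist.
rewrite norm_prime_cpow// -/r -(rmorph1 (real_complex R)) -rmorphB.
rewrite -fmorphV lecR; lra.
Qed.

Lemma euler_prodS (n : nat) :
  euler_prod s n.+1 = euler_prod s n * (1 - w n.+1)^-1.
Proof. by rewrite /euler_prod big_nat_recr. Qed.

Lemma cvg_prime_powR :
  cvgn (series (fun n => (nth_prime n.+1)%:R `^ (- sigma) : R)).
Proof.
apply: series_le_cvg (cvg_riemannR s_gt1) => n; first exact: powR_ge0.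
  by rewrite ltW// riemannR_gt0.
have [pp np] := nth_primeP n.
rewrite powRN lef_pV2 ?posrE ?powR_gt0 ?ltr0n// ?prime_gt0//.
by rewrite ge0_ler_powR// ?nnegrE// ler_nat.
Qed.

(** With r = p(l)^(-Re s), each factor has modulus at most 1 + 2r <= exp(2r), so the products stay
    below the exponential of twice the convergent sum of the r. *)
Lemma euler_prod_bounded : exists M : R, forall n, `|euler_prod s n| <= M%:C.
Proof.
pose r n : R := (nth_prime n.+1)%:R `^ (- sigma).
have r0 n : 0 <= r n by exact: powR_ge0.
have step n : `|euler_prod s n| <= (expR (2 * series r n))%:C.
  elim: n => [|n IH].
    by rewrite /euler_prod /series /= !big_geq// mulr0 expR0 normr1.
  rewrite euler_prodS normrM /series /= big_nat_recr//= mulrDr expRD rmorphM.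
  apply: ler_pM => //.
  rewrite -[(1 - _)^-1](subrK 1) (le_trans (ler_normD _ _))// normr1.
  have le1 := expR_ge1Dx (2 * r n); rewrite -lecR rmorphD rmorph1 addrC in le1.
  by apply: le_trans le1; rewrite lerD2r; exact: norm_euler_factor_sub1.
exists (expR (2 * limn (series r))) => n.
rewrite (le_trans (step n))// lecR ler_expR.
rewrite ler_pM2l//; apply: nondecreasing_cvgn_le; last exact: cvg_prime_powR.
by apply/nondecreasing_seqP => m; rewrite /series /= big_nat_recr//= lerDl.
Qed.

(** An increment is the preceding product times a factor minus 1, hence at most 2 M p(n+1)^(-Re s),
    which is summable. *)
Lemma is_cvg_euler_prod : cvg ((euler_prod s : nat -> R[i]^o) @ \oo).
Proof.
have [M Mn] := euler_prod_bounded.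
apply: (@cvg_complex_increments _ _
  (fun n => M * 2 * (nth_prime n.+1)%:R `^ (- sigma))) => [n|].
  rewrite euler_prodS -{2}[euler_prod s n]mulr1 -mulrBr normrM -mulrA rmorphM.
  by rewrite ler_pM// norm_euler_factor_sub1.
exact: (is_cvg_seriesZ (k := M * 2) cvg_prime_powR).
Qed.

(** The limit behind the inner standard part: for fixed μ the number N = h_μ^2 of factors is fixed,
    and only the length of the geometric sums grows. *)
Lemma cvg_truncated_euler_prod (N : nat) :
  ((fun n => \prod_(1 <= l < N.+1) \sum_(j < n) w l ^+ j) : nat -> R[i]^o) @ \oo
    --> (euler_prod s N : R[i]^o).
Proof.
rewrite /euler_prod; elim: N => [|N IH].
  by under eq_fun do rewrite big_geq//; rewrite big_geq//; exact: cvg_cst.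
under eq_fun do rewrite big_nat_recr//=; rewrite big_nat_recr//=.
apply: (@cvgM R[i]) => //.
have N0 := one_sub_prime_cpow_neq0 (ltn0Sn N).
have -> : (fun n => \sum_(j < n) w N.+1 ^+ j) =
    (fun n => (1 - w N.+1 ^+ n) * (1 - w N.+1)^-1).
  apply/funext => n; apply: (mulIf N0); rewrite mulfVK// mulrC.
  by rewrite -opprB mulNr -subrX1 opprB.
rewrite -[X in _ --> X]mul1r; apply: (@cvgM R[i]); last exact: cvg_cst.
rewrite -[X in _ --> X]subr0; apply: (@cvgB _ R[i]^o); first exact: cvg_cst.
apply/cvgcP => e e0.
have r1 : `|(nth_prime N.+1)%:R `^ (- sigma)| < 1 :> R.
  by rewrite ger0_norm ?powR_ge0// (le_lt_trans (prime_powR_le_half _))//; lra.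
have /cvgrPdist_lt /(_ _ e0) := cvg_expr r1; apply: filterS => n.
have -> : `|w N.+1 ^+ n - 0| = ((nth_prime N.+1)%:R `^ (- sigma) ^+ n)%:C.
  by rewrite subr0 normrX norm_prime_cpow// -rmorphXn.
by rewrite sub0r normrN ltcR ger0_norm// exprn_ge0// powR_ge0.
Qed.

End EulerProduct.

(** * The finite factors of the lattice and of Y_Z *)

Section FiniteLattice.
Context {R : realType}.
Implicit Types (h : int) (a : R -> R).

(** One coordinate of [lattice] and, with h' in place of h, of [lattice']. *)
Definition fin_lattice h : set R :=
  [set x | (exists z : int, x = h%:~R^-1 * z%:~R) /\
           - (h%:~R / 2) <= x < h%:~R / 2].

Definition lattice_pt h (i : nat) : R := i%:R / h%:~R - h%:~R / 2.

(** The point z/h receives the index z + h^2/2, which runs from 0 to h^2 - 1; for h = 2(n+1) the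
    shift h^2/2 is the integer 2(n+1)^2. *)
Lemma fin_latticeE h (n : nat) : h = 2 * n.+1%:Z ->
  fin_lattice h = range (fun i : 'I_(`|h| ^ 2) => lattice_pt h i).
Proof.
move=> hE; have h0 : 0 < h%:~R :> R by rewrite ltr0z hE.
have hn : h%:~R = 2 * n.+1%:R :> R by rewrite hE intrM.
have n0 : n.+1%:R != 0 :> R by rewrite pnatr_eq0.
have ptE (z : int) : h%:~R^-1 * z%:~R =
    (z + 2 * n.+1%:Z ^+ 2)%:~R / h%:~R - h%:~R / 2 :> R.
  by rewrite hn intrD intrM rmorphXn /=; field.
apply/seteqP; split=> [x [[z ->] /andP[zl zu]]|_ [i _ <-]].
  have zl' : - (2 * n.+1%:Z ^+ 2) <= z.
    rewrite -(ler_int R) -(ler_pM2l (_ : 0 < h%:~R^-1)) ?invr_gt0//.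
    apply: le_trans zl; rewrite le_eqVlt; apply/orP; left; apply/eqP.
    by rewrite hn intrN intrM rmorphXn /=; field.
  have zu' : z < 2 * n.+1%:Z ^+ 2.
    rewrite -(ltr_int R) -(ltr_pM2l (_ : 0 < h%:~R^-1)) ?invr_gt0//.
    apply: lt_le_trans zu _; rewrite le_eqVlt; apply/orP; left; apply/eqP.
    by rewrite hn intrM rmorphXn /=; field.
  have iN : (`|(z + 2 * n.+1%:Z ^+ 2)%R| < `|h| ^ 2)%N by nia.
  exists (Ordinal iN) => //=; rewrite ptE /lattice_pt /=.
  by rewrite natr_absz ger0_norm//; lia.
split.
  exists (i%:Z - 2 * n.+1%:Z ^+ 2); rewrite ptE /lattice_pt; congr (_ / _ - _).
  by rewrite subrK.
rewrite /lattice_pt lerBrDl subrr divr_ge0 ?ler0n ?ltW//=.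
rewrite ltrBlDr -splitr ltr_pdivrMr// -intrM pmulrn ltr_int.
have := ltn_ord i; nia.
Qed.

Lemma lattice_pt_inj h : 0 < h -> injective (lattice_pt h).
Proof.
move=> h0 i j /addIr /mulIf ij; apply/eqP; rewrite -(eqr_nat R); apply/eqP/ij.
by rewrite invr_eq0 intr_eq0 gt_eqF.
Qed.

Lemma truncn_lattice_pt h i : 0 < h ->
  Num.truncn (h%:~R * (lattice_pt h i + h%:~R / 2) + 1) = i.+1.
Proof.
move=> h0; rewrite subrK mulrC divfK ?intr_eq0 ?gt_eqF//.
by rewrite natr1 natrK.
Qed.

Definition fin_YZ h h' : set (R -> R) :=
  [set a | (forall t, fin_lattice h t ->
              fin_lattice h' (a t) /\ exists z : int, a t = z%:~R) /\
           (forall t, ~ fin_lattice h t -> a t = 0)].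

(** For h > 0 at most one term survives at [t], and none off the lattice. The offset h'/2 makes the
    exponent a(k) + h'/2 equal to the index [f i]. *)
Definition step_fun h h' (f : {ffun 'I_(`|h| ^ 2) -> 'I_`|h'|}) (t : R) : R :=
  \sum_(i < `|h| ^ 2 | t == lattice_pt h i) ((f i)%:R - h'%:~R / 2).

Lemma step_fun_pt h h' (f : {ffun 'I_(`|h| ^ 2) -> 'I_`|h'|}) (i : 'I_(`|h| ^ 2)) :
  0 < h ->
  step_fun f (lattice_pt h i) = (f i)%:R - h'%:~R / 2.
Proof.
move=> h0; rewrite /step_fun (eq_bigl (pred1 i)) ?big_pred1_eq// => j /=.
by rewrite (inj_eq (lattice_pt_inj h0)) eq_sym.
Qed.

Lemma step_fun_inj h h' : 0 < h -> injective (@step_fun h h').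
Proof.
move=> h0 f g fg; apply/ffunP => i; apply/val_inj/eqP; rewrite /= -(eqr_nat R).
have := congr1 (fun a => a (lattice_pt h i)) fg; rewrite /= !step_fun_pt//.
by move/addIr/eqP.
Qed.

(** As h' is even, h'/2 is an integer, so the integers of [-h'/2, h'/2) are exactly the j - h'/2
    with 0 <= j < h'. *)
Lemma fin_YZE h h' (n n' : nat) : h = 2 * n.+1%:Z -> h' = 2 * n'.+1%:Z ->
  fin_YZ h h' = range (@step_fun h h').
Proof.
move=> hE hE'; have h0 : 0 < h by rewrite hE.
have hn' : h'%:~R / 2 = n'.+1%:R :> R by rewrite hE' intrM mulrC mulKf ?pnatr_eq0.
have h0' : h'%:~R != 0 :> R by rewrite hE' intr_eq0.
apply/seteqP; split=> [a [aL a0]|_ [f _ <-]].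
  (* The second alternative makes the choice total and is excluded below, since every
     [lattice_pt h i] belongs to the lattice. *)
  have fP i : {j : 'I_`|h'| | a (lattice_pt h i) = j%:R - h'%:~R / 2 \/
      ~ fin_lattice h (lattice_pt h i)}.
    apply: cid; have [/aL[[_ /andP[al au]] [z az]]|] :=
      pselect (fin_lattice h (lattice_pt h i)); last first.
      have j0 : (0 < `|h'|)%N by rewrite hE'.
      by move=> ni; exists (Ordinal j0); right.
    move: al au; rewrite az hn' pmulrn -intrN ler_int ltr_int => al au.
    have jh : (`|(z + n'.+1%:Z)%R| < `|h'|)%N by lia.
    exists (Ordinal jh); left; rewrite /= natr_absz ger0_norm; last by lia.
    by rewrite intrD addrK.
  exists [ffun i : 'I_(`|h| ^ 2) => sval (fP i)] => //; apply/funext => t.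
  have [|tL] := pselect (fin_lattice h t).
    rewrite {1}(fin_latticeE hE) => -[i _ <-]; rewrite step_fun_pt// ffunE.
    case: (fP i) => j /= [->//|[]].
    by rewrite (fin_latticeE hE); exists i.
  rewrite a0// /step_fun big_pred0// => i; apply/negP => /eqP ti.
  by apply: tL; rewrite (fin_latticeE hE) ti; exists i.
split=> t; last first.
  move=> tL; rewrite /step_fun big_pred0// => i; apply/negP => /eqP ti.
  by apply: tL; rewrite (fin_latticeE hE) ti; exists i.
rewrite {1}(fin_latticeE hE) => -[i _ <-]; rewrite step_fun_pt//.
have vE : (f i)%:R - h'%:~R / 2 = ((f i)%:Z - n'.+1%:Z)%:~R :> R.
  by rewrite hn' intrB.
split; last by exists ((f i)%:Z - n'.+1%:Z).
(* An integer v is the lattice point (h' v) / h'. *)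
split; first by exists (h' * ((f i)%:Z - n'.+1%:Z)); rewrite intrM mulKf.
have := ltn_ord (f i); rewrite vE hn' pmulrn -intrN ler_int ltr_int; lia.
Qed.

Lemma fsbig_range (K : Type) (idx : K) (op : Monoid.com_law idx) (I : finType)
    (J : choiceType) (f : I -> J) (F : J -> K) : injective f ->
  \big[op/idx]_(j \in range f) F j = \big[op/idx]_(i : I) F (f i).
Proof.
move=> f_inj; rewrite fsbig_image; last by move=> x y _ _; exact: f_inj.
rewrite [RHS](fsbig_seq _ _ (index_enum_uniq I)); apply: eq_fsbigl.
by apply/seteqP; split=> i //= _; exact: mem_index_enum.
Qed.

Definition fin_Z (s : R[i]) h h' a : R[i] :=
  \big[*%R/1]_(t \in fin_lattice h)
    cpow (nth_prime (Num.truncn (h%:~R * (t + h%:~R / 2) + 1)))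
      (- s * (a t + h'%:~R / 2)%:C).

(** [fin_YZ] is parametrized by all functions f from lattice indices to exponents below h', and
    [fin_Z] becomes the product of the (p(i+1)^(-s))^(f i). Distributivity of product over sum then
    gives the right-hand side. *)
Lemma sum_fin_Z (s : R[i]) h h' (n n' : nat) :
  h = 2 * n.+1%:Z -> h' = 2 * n'.+1%:Z ->
  \sum_(a \in fin_YZ h h') fin_Z s h h' a =
  \prod_(1 <= l < (`|h| ^ 2).+1) \sum_(j < `|h'|) cpow (nth_prime l) (- s) ^+ j.
Proof.
move=> hE hE'; have h0 : 0 < h by rewrite hE.
rewrite (fin_YZE hE hE') (fsbig_range _ _ (@step_fun_inj h h' h0)).
rewrite big_add1 big_mkord bigA_distr_bigA; apply: eq_bigr => f _.
rewrite /fin_Z (fin_latticeE hE) fsbig_range; last first.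
  by move=> i j /(lattice_pt_inj h0)/val_inj.
apply: eq_bigr => i _; rewrite truncn_lattice_pt// step_fun_pt// subrK.
by rewrite -cpowMn rmorph_nat.
Qed.

End FiniteLattice.

(** * Transfer *)

Section Transfer.
Context {R : realType} {I1 I2 : Type} {F1 : set_system I1} {F2 : set_system I2}.
Context {F1_ultra : UltraFilter F1} {F2_ultra : UltraFilter F2}.
Local Notation D := (fubini_filter F1 F2).

(** The tolerances depend on μ alone. Uniqueness of the standard part is needed because [star_st]
    chooses some admissible value. *)
Lemma star_st_dcls (V : I2 * I1 -> R[i]) (E : I2 -> R[i]) :
  (forall e : I2 -> R, D [set p | 0 < e p.1 -> `|V p - E p.1| < (e p.1)%:C]) ->
  star_st (dcls V : dstar F1 F2 R[i]) = ucls F2 E.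
Proof.
move=> VE; rewrite /star_st.
have stP (y : star F2 R[i]) (e : star F2 R) :
    drel2 (fun z (u : R) => `|z| < u%:C)
      (dlift2 (fun a b => a - b) (dcls V : dstar F1 F2 R[i]) (emb F1 y)) (emb F1 e)
    <-> D [set p | `|V p - urep y p.1| < (urep e p.1)%:C].
  by rewrite !embE dlift2_dcls drel2_dcls.
case: xgetP => [y _ yV|/(_ (ucls F2 E))]; last first.
  case=> e e0; apply/stP.
  have E' : D [set p | urep (ucls F2 E) p.1 = E p.1].
    by apply/(fubini_fst [set m | urep (ucls F2 E) m = E m]); exact: urep_ucls.
  have e0' : D [set p | 0 < urep e p.1].
    by apply/(fubini_fst [set m | 0 < urep e m]).
  by apply: filterS3 E' e0' (VE (urep e)) => p /= -> e0p; exact.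
rewrite -[y]urepK; apply/ucls_eq; apply: contrapT => /ultraC yE.
(* Half the distance between the two candidates contradicts the triangle inequality; [complex.Re]
   converts the complex-valued norm to a real number. *)
pose d m : R := complex.Re `|urep y m - E m| / 2.
have dE m : (d m)%:C + (d m)%:C = `|urep y m - E m|.
  by rewrite -(rmorphD (real_complex R)) /d -splitr normc_def.
have d0 : F2 [set m | 0 < d m].
  apply: filterS yE => m /= /eqP; rewrite -subr_eq0 -normr_gt0.
  by case/gt0c => _; rewrite /d => ?; lra.
have d0' : rel1 (fun u : R => 0 < u) (ucls F2 d) by apply/rel1_ucls.
have /stP yd := yV _ d0'.
have dd : D [set p | urep (ucls F2 d) p.1 = d p.1].
  by apply/(fubini_fst [set m | urep (ucls F2 d) m = d m]); exact: urep_ucls.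
have {}d0 : D [set p | 0 < d p.1] by apply/(fubini_fst [set m | 0 < d m]).
have {}yd : D [set p | `|V p - urep y p.1| < (d p.1)%:C].
  by apply: filterS2 dd yd => p /= ->.
apply: (@filter_not_empty _ D _).
apply: filterS3 d0 yd (VE d) => p /= d0p yd /(_ d0p) Vd.
have := ler_distD (V p) (urep y p.1) (E p.1).
rewrite [`|urep y p.1 - V p|]distrC => /le_lt_trans /(_ (ltrD yd Vd)).
by rewrite dE ltxx.
Qed.

Lemma st_ucls (E : I2 -> R[i]) (y : R[i]) :
  (forall e : R, 0 < e -> F2 [set m | `|E m - y| < e%:C]) ->
  st (ucls F2 E) = y.
Proof.
move=> Ey; rewrite /st; case: xgetP => [x _ xE|/(_ y)]; last first.
  by case=> e e0; apply/rel1_ucls; exact: Ey.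
apply: contrapT => /eqP; rewrite -subr_eq0 -normr_gt0 => xy.
have [xyE xy0] := gt0c xy.
pose d : R := complex.Re `|x - y| / 2.
have d0 : 0 < d by rewrite /d; lra.
have /rel1_ucls xd := xE _ d0.
apply: (@filter_not_empty _ F2 _); apply: filterS2 xd (Ey _ d0) => m /= xd yd.
have := ler_distD (E m) x y; rewrite [`|x - E m|]distrC => /le_lt_trans.
move/(_ _ (ltrD xd yd)).
by rewrite -(rmorphD (real_complex R)) /d -splitr normc_def ltxx.
Qed.

(** * The lattices, [YZ] and [Zfun] in coordinates *)

Context (H : star F2 int) (H' : dstar F1 F2 int).
Local Notation h m := (urep H m).
Local Notation h' p := (drep H' p).
Context (H_good : F2 [set m | exists n : nat, h m = 2 * n.+1%:Z]).
Context (H'_good : D [set p | exists n : nat, h' p = 2 * n.+1%:Z]).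

Let H_good2 : D [set p | exists n : nat, h p.1 = 2 * n.+1%:Z].
Proof. exact/(fubini_fst [set m | exists n : nat, h m = 2 * n.+1%:Z]). Qed.

Lemma latticeP (x : star F2 R) :
  lattice H x <-> F2 [set m | fin_lattice (h m) (urep x m)].
Proof.
split=> [[[z xz] xb]|xL].
  have {}xz : F2 [set m | urep x m = (h m)%:~R^-1 * (urep z m)%:~R].
    by apply/ucls_eq; rewrite urepK.
  by apply: filterS2 xz xb => m xz xb; split=> //; exists (urep z m).
split; last by apply: filterS xL => m [].
pose z m := xget 0 [set z : int | urep x m = (h m)%:~R^-1 * z%:~R].
exists (ucls F2 z); rewrite -[LHS]urepK; apply/ucls_eq.
apply: filterS2 (urep_ucls z) xL => m /= -> [[w xw] _].
apply: (@xgetPex _ 0 [set z : int | urep x m = (h m)%:~R^-1 * z%:~R]).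
by exists w.
Qed.

Lemma lattice'P (x : dstar F1 F2 R) :
  lattice' H' x <-> D [set p | fin_lattice (h' p) (drep x p)].
Proof.
split=> [[[z xz] xb]|xL].
  have {}xz : D [set p | drep x p = (h' p)%:~R^-1 * (drep z p)%:~R].
    by apply/dcls_eq; rewrite drepK.
  have {}xb : D [set p | - ((h' p)%:~R / 2) <= drep x p < (h' p)%:~R / 2] := xb.
  by apply: filterS2 xz xb => p xz xb; split=> //; exists (drep z p).
split.
  pose z p := xget 0 [set z : int | drep x p = (h' p)%:~R^-1 * z%:~R].
  exists (dcls z); rewrite -[LHS]drepK -{1}(drepK H') dlift2_dcls.
  apply/dcls_eq; apply: filterS xL => p [[w xw] _].
  apply: (@xgetPex _ 0 [set z : int | drep x p = (h' p)%:~R^-1 * z%:~R]).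
  by exists w.
by change (D [set p | - ((h' p)%:~R / 2) <= drep x p < (h' p)%:~R / 2]);
  apply: filterS xL => p [].
Qed.

(** Membership in [star_set] asks for a representing internal function with all its values in L,
    whereas the coordinates lie in the finite lattice only almost everywhere; the gap is closed by
    testing at a bad index in one direction and by changing values in the other. *)
Lemma star_setP (x : dstar F1 F2 R) :
  star_set F1 (lattice H) x <-> D [set p | fin_lattice (h p.1) (drep x p)].
Proof.
split=> [[f fL xf]|xL].
  have {}xf : D [set p | drep x p = urep f p.1 p.2].
    by apply/dcls_eq; rewrite drepK.
  suff : D [set p | fin_lattice (h p.1) (urep f p.1 p.2)].
    by apply: filterS2 xf => p /= ->.
  apply: contrapT => /ultraC nL.
  have [i0 _] := filter_ex (@filterT _ F1 _).
  (* [v m] is an index at which [f] leaves the lattice, if there is one; evaluation at the class of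
     [v] then contradicts [fL]. *)
  have /choice[v vP] : forall m, exists k, forall l,
      ~ fin_lattice (h m) (urep f m l) -> ~ fin_lattice (h m) (urep f m k).
    move=> m.
    have [[l nl]|nl] := pselect (exists l, ~ fin_lattice (h m) (urep f m l)).
      by exists l.
    by exists i0 => l ?; case: nl; exists l.
  have nv : F2 [set m | ~ fin_lattice (h m) (urep f m (v m))].
    by move: nL; apply: (@filterS _ F2) => m /filter_ex[l /vP].
  have /latticeP vL := fL (ucls F2 v).
  apply: (@filter_not_empty _ F2 _).
  have vv : F2 [set m |
      urep (lift2 (fun g j => g j) f (ucls F2 v)) m = urep f m (v m)].
    by apply/ucls_eq; rewrite urepK; apply/ucls_eq;
      apply: filterS (urep_ucls v) => m /= ->.
  by apply: filterS3 nv vL vv => m /= nv + vv; rewrite vv.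
(* Values off the lattice are replaced by its left endpoint -h/2. *)
pose f m l := if pselect (fin_lattice (h m) (drep x (m, l))) then drep x (m, l)
              else lattice_pt (h m) 0.
exists (ucls F2 f) => [w|].
  have fw : F2 [set m |
      urep (lift2 (fun g j => g j) (ucls F2 f) w) m = f m (urep w m)].
    by apply/ucls_eq; rewrite urepK; apply/ucls_eq;
      apply: filterS (urep_ucls f) => m /= ->.
  apply/latticeP; apply: filterS2 fw H_good => m /= -> [n hn].
  rewrite /f; case: pselect => [//|nxL /=].
  have N0 : (0 < `|h m| ^ 2)%N by rewrite hn.
  by rewrite (fin_latticeE hn); exists (Ordinal N0).
transitivity (dcls (fun p => f p.1 p.2) : dstar F1 F2 R).
  by rewrite -[LHS]drepK; apply/dcls_eq; apply: filterS xL => -[m l] /=;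
    rewrite /f; case: pselect.
by apply/ucls_eq; apply: filterS (urep_ucls f) => m /= ->.
Qed.

(** For almost every μ the lattice is finite, so the family over λ is [F1]-almost everywhere equal
    to one point c(μ), and [x] is the image of the class of c. *)
Lemma star_set_emb (x : dstar F1 F2 R) :
  star_set F1 (lattice H) x -> exists2 k, lattice H k & emb F1 k = x.
Proof.
move=> /star_setP xL.
pose P m := [set c : R | fin_lattice (h m) c /\ F1 [set l | drep x (m, l) = c]].
pose c m := xget 0 (P m).
have Pc : F2 [set m | P m (c m)].
  move: H_good xL; apply: (@filterS2 _ F2) => m [n hn] xL.
  have [i xi] : exists i : 'I_(`|h m| ^ 2),
      F1 [set l | drep x (m, l) = lattice_pt (h m) i].
    apply: ultra_finite_range; apply: filterS xL => l /=.
    by rewrite {1}(fin_latticeE hn) => -[i _ xi]; exists i.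
  apply: (@xgetPex _ 0 (P m)); exists (lattice_pt (h m) i); split=> //.
  by rewrite (fin_latticeE hn); exists i.
exists (ucls F2 c).
  by apply/latticeP; apply: filterS2 (urep_ucls c) Pc => m /= -> [].
rewrite emb_ucls -[RHS]drepK; apply/dcls_eq.
by move: Pc; apply: (@filterS _ F2) => m [_]; apply: filterS => l; exact: esym.
Qed.

Lemma emb_lattice : [set emb F1 k | k in lattice H] =
  dset (dcls (fun p => fin_lattice (h p.1)) : dstar F1 F2 (set R)).
Proof.
apply/seteqP; split=> [_ [k /latticeP kL <-]|x].
  rewrite embE; apply/dset_dcls.
  exact/(fubini_fst [set m | fin_lattice (h m) (urep k m)]).
by rewrite -{1}[x]drepK => /dset_dcls /star_setP /star_set_emb[k kL <-]; exists k.
Qed.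

(** If almost all coordinates of [a] failed, a failing argument could be chosen in each; its class,
    inside or outside the ultrapower of L, would violate a defining condition of [YZ]. *)
Lemma YZP (a : dstar F1 F2 (R -> R)) :
  YZ H H' a <-> D [set p | fin_YZ (h p.1) (h' p) (drep a p)].
Proof.
split=> [[[aL a0] aZ]|aYZ].
  apply: contrapT => /ultraC na.
  (* The three possible failures: a value outside L', a non-integral value, a nonzero value off the
     lattice. *)
  pose bad1 p t := fin_lattice (h p.1) t /\ ~ fin_lattice (h' p) (drep a p t).
  pose bad2 p t := fin_lattice (h p.1) t /\ ~ exists z : int, drep a p t = z%:~R.
  pose bad3 p t := ~ fin_lattice (h p.1) t /\ drep a p t <> 0.
  pose B p := [set t : R | bad1 p t \/ bad2 p t \/ bad3 p t].
  pose x p := xget 0 (B p).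
  have xB : D [set p | B p (x p)].
    apply: filterS na => p np; apply: (@xgetPex _ 0 (B p)).
    apply: contrapT => /forallNP nB; apply: np; split=> t tL.
      split; apply: contrapT => nt; apply: (nB t); first by left.
      by right; left.
    by apply: contrapT => nt; apply: (nB t); right; right.
  have xx : D [set p | drep (dcls x : dstar F1 F2 R) p = x p] by exact: drep_dcls.
  have ax : D [set p | drep (dapp a (dcls x)) p = drep a p (x p)].
    by apply/dcls_eq; rewrite drepK -[in LHS](drepK a) dapp_dcls.
  have [xL|nxL] := pselect (star_set F1 (lattice H) (dcls x)).
    have /star_setP xL' := xL; have /lattice'P axL := aL _ xL.
    (* Integrality is given only at points embedded from L, so the class of [x] must first be
       recognized as one of them. *)
    have [k kL kx] := star_set_emb xL; have [z] := aZ k kL; rewrite kx => az.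
    have {}az : D [set p | drep (dapp a (dcls x)) p = (drep z p)%:~R].
      by apply/dcls_eq; rewrite drepK.
    apply: (@filter_not_empty _ D _).
    apply: filterS3 xB xL' (filterI (filterI axL az) (filterI ax xx)) => p /=.
    move=> Bx pL [[apL apZ] [axp xp]]; rewrite axp in apL apZ; rewrite xp in pL.
    by case: Bx => [[]//|[[_ []]|[]//]]; exists (drep z p).
  have a0x : D [set p | drep (dapp a (dcls x)) p = 0].
    apply/(@dcls_eq _ _ _ _ _ _ _ _ (fun=> 0)); rewrite drepK (a0 _ nxL).
    exact: dcstE.
  have {}nxL : D [set p |
      ~ fin_lattice (h p.1) (drep (dcls x : dstar F1 F2 R) p)].
    apply: (@ultraC _ D _ [set p |
      fin_lattice (h p.1) (drep (dcls x : dstar F1 F2 R) p)]) => xL.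
    exact/nxL/star_setP.
  apply: (@filter_not_empty _ D _).
  apply: filterS3 xB nxL (filterI a0x (filterI ax xx)) => p /=.
  move=> Bx pL [ap0 [axp xp]]; rewrite axp in ap0; rewrite xp in pL.
  by case: Bx => [[]//|[[]//|[_]]].
have dk k : D [set p | drep (dapp a k) p = drep a p (drep k p)].
  exact: dapp_drep.
split; first split.
- move=> k /star_setP kL; apply/lattice'P.
  by apply: filterS3 aYZ kL (dk k) => p [ap _] /ap[? _] /= ->.
- move=> k nk; have {}nk : D [set p | ~ fin_lattice (h p.1) (drep k p)].
    apply: (@ultraC _ D _ [set p | fin_lattice (h p.1) (drep k p)]) => kL.
    exact/nk/star_setP.
  rewrite dcstE -[LHS]drepK; apply/dcls_eq.
  by apply: filterS3 aYZ nk (dk k) => p [_ ap] /ap ? /= ->.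
- move=> k /latticeP kL.
  have {}kL : D [set p | fin_lattice (h p.1) (urep k p.1)].
    exact/(fubini_fst [set m | fin_lattice (h m) (urep k m)]).
  pose z p := xget 0 [set z : int | drep a p (urep k p.1) = z%:~R].
  exists (dcls z); rewrite dlift1_dcls embE -{1}(drepK a) dapp_dcls.
  apply/dcls_eq; apply: filterS2 aYZ kL => p [ap _] /ap[_ az].
  exact: (@xgetPex _ 0 [set z : int | drep a p (urep k p.1) = z%:~R] az).
Qed.

Lemma Zfun_dcls (s : R[i]) (a : dstar F1 F2 (R -> R)) :
  Zfun H H' s a = dcls (fun p => fin_Z s (h p.1) (h' p) (drep a p)).
Proof.
apply: (@hbig_dcls I1 I2 F1 F2 _ _ _ _ *%R _ 0).
- apply: filterS H_good2 => p [n hn] /=; rewrite (fin_latticeE hn).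
  exact: finite_image.
- by move=> x y _ _; exact: emb_inj.
- exact: emb_lattice.
move=> k kL; rewrite /qprime /ptilde.
pose l m := Num.truncn ((h m)%:~R * (urep k m + (h m)%:~R / 2) + 1).
have -> : lift1 nth_prime (ucls F2 l) = ucls F2 (fun m => nth_prime (l m)).
  by apply/ucls_eq; apply: filterS (urep_ucls l) => m /= ->.
rewrite emb_ucls embE -{1}(drepK a) -{1}(drepK H') !(dlift2_dcls, dapp_dcls).
by [].
Qed.

(** With [YZ] internal by [YZP] and [Zfun] internal by [Zfun_dcls], the hyperfinite sum is taken
    coordinatewise and evaluated by [sum_fin_Z]. *)
Lemma hsum_dcls (s : R[i]) :
  hbig +%R 0 (@id (dstar F1 F2 (R -> R))) (YZ H H') (Zfun H H' s) =
  dcls (fun p => \prod_(1 <= l < (`|h p.1| ^ 2).+1)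
    \sum_(j < `|h' p|) cpow (nth_prime l) (- s) ^+ j).
Proof.
rewrite (@hbig_dcls I1 I2 F1 F2 _ _ _ _ +%R _ 0 _ _ _ _
  (fun p => fin_YZ (h p.1) (h' p)) (fun p => fin_Z s (h p.1) (h' p))).
- apply/dcls_eq; apply: filterS2 H_good2 H'_good => p [n hn] [n' hn'].
  exact: (sum_fin_Z s hn hn').
- apply: filterS2 H_good2 H'_good => p [n hn] [n' hn'].
  by rewrite /= (fin_YZE hn hn'); exact: finite_image.
- by [].
- rewrite image_id; apply/seteqP; split=> a.
    by move=> /YZP aYZ; rewrite -[a]drepK; apply/dset_dcls.
  by rewrite -{1}[a]drepK => /dset_dcls aYZ; apply/YZP.
by move=> a _; rewrite Zfun_dcls -{2}[a]drepK dapp_dcls.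
Qed.

End Transfer.

(** * The two standard parts of the hyperfinite sum *)

Theorem theorem7p2 (R : realType) (I1 I2 : Type)
    (F1 : set_system I1) (F2 : set_system I2)
    (I1_infinite : infinite_set [set: I1])
    (I2_infinite : infinite_set [set: I2])
    (F1_ultra : UltraFilter F1) (F2_ultra : UltraFilter F2)
    (F1_nonprincipal : forall i : I1, F1 <> principal_filter i)
    (F2_nonprincipal : forall i : I2, F2 <> principal_filter i)
    (H : star F2 int)
    (H_pos : rel1 (fun h : int => 0 < h) H)
    (H_even : exists h : star F2 int, H = lift1 (fun w : int => 2 * w) h)
    (H_infinite : forall n : nat, rel1 (fun h : int => n%:Z < h) H)
    (H' : dstar F1 F2 int)
    (H'_pos : drel1 (fun h : int => 0 < h) H')
    (H'_even : exists h : dstar F1 F2 int,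
       H' = dlift1 (fun w : int => 2 * w) h)
    (H'_infinite : forall z : star F2 int,
       drel2 (fun w h : int => w < h) (emb F1 z) H')
    (s : R[i]) (s_gt1 : 1 < complex.Re s) :
  let S : dstar F1 F2 R[i] :=
    hbig +%R 0 (@id (dstar F1 F2 (R -> R))) (YZ H H') (Zfun H H' s) in
  [/\ star_bounded S,
      finite_elt (star_st S),
      cvg ((euler_prod s : nat -> R[i]^o) @ \oo) &
      st (star_st S) = zeta s].
Proof.
have H_good : F2 [set m | exists n : nat, urep H m = 2 * n.+1%:Z].
  have [w Hw] := H_even.
  have {}Hw : F2 [set m | urep H m = 2 * urep w m].
    by apply/ucls_eq; rewrite urepK.
  by apply: filterS2 H_pos Hw => m /= H0 Hm; exists `|urep w m|.-1; lia.
have H'_good : fubini_filter F1 F2 [set p | exists n : nat, drep H' p = 2 * n.+1%:Z].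
  have [w Hw] := H'_even.
  have {}Hw : fubini_filter F1 F2 [set p | drep H' p = 2 * drep w p].
    by apply/dcls_eq; rewrite drepK.
  have H0 : fubini_filter F1 F2 [set p | 0 < drep H' p] := H'_pos.
  by apply: filterS2 H0 Hw => p /= {}H0 Hp; exists `|drep w p|.-1; lia.
move=> S; rewrite /S hsum_dcls//.
set V := fun p : I2 * I1 => _.
(* The inner standard part will be the class of the Euler products truncated at h_μ^2. *)
pose E m := euler_prod s (`|urep H m| ^ 2).
have VE (e : I2 -> R) :
    fubini_filter F1 F2 [set p | 0 < e p.1 -> `|V p - E p.1| < (e p.1)%:C].
  (* The threshold [b] depends on μ alone, so it defines an element of the first extension of the
     integers, which H' exceeds by hypothesis. *)
  have /choice[b bP] m : exists b : nat, 0 < e m -> forall n, (b <= n)%N ->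
      `|\prod_(1 <= l < (`|urep H m| ^ 2).+1)
          \sum_(j < n) cpow (nth_prime l) (- s) ^+ j - E m| < (e m)%:C.
    have [em|] := boolP (0 < e m); last by exists 0%N.
    have /cvgcP /(_ _ em)[b _ bn] :=
      cvg_truncated_euler_prod s_gt1 (N := (`|urep H m| ^ 2)%N).
    by exists b => _ n nb; exact: bn.
  have bH' : fubini_filter F1 F2 [set p | (b p.1)%:Z < drep H' p].
    have := H'_infinite (ucls F2 (fun m => (b m)%:Z)).
    by rewrite emb_ucls -{1}(drepK H') => /drel2_dcls.
  by apply: filterS bH' => p /= bp /bP; apply; lia.
have stE := star_st_dcls VE.
have [M EM] := euler_prod_bounded s_gt1.
rewrite stE; split.
(* [M] bounds every truncated Euler product, and the sum is within 1 of one of them almost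
   everywhere. *)
- exists (ucls F2 (fun m => M + 1)); rewrite emb_ucls; apply/drel2_dcls.
  apply: filterS (VE (fun=> 1)) => p /(_ ltr01) Vp.
  rewrite /= -[V p](subrK (E p.1)) addrC rmorphD /=.
  by rewrite (le_trans (ler_normD _ _))// lerD// ?EM// ltW.
- by exists M; apply/rel1_ucls; apply: filterS filterT => m _; exact: EM.
- exact: is_cvg_euler_prod.
apply: st_ucls => e e0.
(* Since h_μ > N for almost every μ, the truncation point h_μ^2 lies beyond N. *)
have /cvgcP /(_ _ e0)[N _ NE] := is_cvg_euler_prod s_gt1.
by apply: filterS (H_infinite N) => m /= NH; apply: NE => /=; nia.
Qed.
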